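(* Let $\Gamma$ be a finite connected $(G,s)$-geodesic-transitive digraph for some integer $s\geq 2$, where $G\leq \mathrm{Aut}(\Gamma)$, and let $N$ be a normal subgroup of $G$ which is maximal (with respect to inclusion) among normal subgroups of $G$ having at least $3$ orbits on $V(\Gamma)$. Then the quotient $\Gamma_N$ is connected and $(G/N,s')$-geodesic-transitive, where $s'=\min\{s,\mathrm{diam}(\Gamma_N)\}$, and $G/N$ is either quasiprimitive or bi-quasiprimitive on $V(\Gamma_N)$. Moreover, $\Gamma_N$ is either a digraph (i.e. its arc relation is antisymmetric) or an undirected complete graph.
   Context: A digraph $\Gamma$ consists of a finite vertex set $V(\Gamma)$ with an antisymmetric irreflexive relation $\rightarrow$; an arc is an ordered pair $(u,v)$ with $u\rightarrow v$. $\Gamma$ is connected if its underlying undirected graph is connected. The distance $d_\Gamma(u,v)$ is the length of a shortest directed path from $u$ to $v$, and $\mathrm{diam}(\Gamma)$ is the maximum distance. An $s$-arc is a sequence $(v_0,\dots,v_s)$ with $v_i\rightarrow v_{i+1}$ for all $i$; it is an $s$-geodesic if $d_\Gamma(v_0,v_s)=s$. For $G\leq\mathrm{Aut}(\Gamma)$, $\Gamma$ is $(G,s)$-geodesic-transitive if $G$ is transitive on the set of $i$-geodesics for each $i\leq s$. For a normal subgroup $N$ of $G$, the quotient $\Gamma_N$ has as vertices the $N$-orbits on $V(\Gamma)$, with $(A,B)$ an arc iff some $a\in A$, $b\in B$ satisfy $a\rightarrow b$; $G/N$ acts on it naturally (if both $(A,B)$ and $(B,A)$ are arcs the pair is regarded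 as an undirected edge). A transitive permutation group is quasiprimitive if every nontrivial normal subgroup is transitive, and bi-quasiprimitive if every nontrivial normal subgroup has at most two orbits and some nontrivial normal subgroup has exactly two orbits. *)

(* Defs.v *)
From mathcomp Require Import all_boot all_fingroup.

Set Implicit Arguments.
Unset Strict Implicit.
Unset Printing Implicit Defensive.

Local Open Scope group_scope.

Section Graphs.

Variables (T : finType) (e : rel T).

Definition digraph : Prop := irreflexive e /\ antisymmetric e.

(* As a relation, an undirected graph is a symmetric one; there are no loops. *)
Definition complete_graph : Prop := forall u v, e u v = (u != v).

Definition graph_connected : Prop :=
  forall u v, connect (fun x y => e x y || e y x) u v.

(* A shortest directed path has length < #|T|; the value is the junk value    *)
(* #|T| exactly when v cannot be reached from u.                              *)
Definition dist (u v : T) : nat :=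
  find (fun n => [exists p : n.-tuple T, path e u p && (last u p == v)])
       (iota 0 #|T|).

Definition diam : nat := \max_(u : T) \max_(v : T) dist u v.

(* The s-arc (v_0, ..., v_s) is encoded as v_0 and the sequence v_1, ..., v_s *)
Definition geodesic (s : nat) (v0 : T) (p : seq T) : bool :=
  [&& size p == s, path e v0 p & dist v0 (last v0 p) == s].

Definition graph_aut : {set {perm T}} :=
  [set g : {perm T} | [forall u, forall v, e (g u) (g v) == e u v]].

Variables (aT : finGroupType) (D : {set aT}) (to : action D T).

Definition acts_as_automorphisms (G : {set aT}) : Prop :=
  [acts G, on [set: T] | to] /\
  {in G, forall g, forall u v, e (to u g) (to v g) = e u v}.

Definition geodesic_transitive (G : {set aT}) (s : nat) : Prop :=
  acts_as_automorphisms G /\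
  forall i, i <= s -> forall (u v : T) (p q : seq T),
    geodesic i u p -> geodesic i v q ->
    exists2 g, g \in G & v :: q = [seq to x g | x <- u :: p].

End Graphs.

Section PermutationGroups.

Variables (aT : finGroupType) (D : {set aT}) (T : finType) (to : action D T).

Definition norbits (K : {set aT}) : nat := #|orbit to K @: [set: T]|.

Definition transitive_permutation_group (G : {set aT}) : Prop :=
  [faithful G, on [set: T] | to] /\ [transitive G, on [set: T] | to].

Definition quasiprimitive (G : {set aT}) : Prop :=
  transitive_permutation_group G /\
  forall K : {group aT}, K <| G -> K :!=: 1 ->
    [transitive K, on [set: T] | to].

Definition bi_quasiprimitive (G : {set aT}) : Prop :=
  [/\ transitive_permutation_group G,
      forall K : {group aT}, K <| G -> K :!=: 1 -> norbits K <= 2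
    & exists K : {group aT}, [/\ K <| G, K :!=: 1 & norbits K = 2]].

End PermutationGroups.

Section Quotient.

Variables (T : finType) (e : rel T) (N : {group {perm T}}).

Definition quotient_vertex : finType :=
  {A : {set T} | A \in orbit 'P N @: [set: T]}.

Definition quotient_arc : rel quotient_vertex :=
  fun A B => [exists a in val A, exists b in val B, e a b].

(* 'P^* is the action of permutations on sets of vertices; it factors through *)
(* N on N-invariant sets, and is then restricted to the set of N-orbits.      *)
Definition quotient_graph_action : action _ quotient_vertex := ('P^* %% N)^?.

Lemma quotient_graph_actionE (A : quotient_vertex) (g : {perm T}) :
  g \in 'N(N) -> val (quotient_graph_action A (coset N g)) = g @: val A.
Proof.
move=> nNg; have orbE (B : {set T}) : B \in orbit 'P N @: [set: T] ->
    forall h, h \in 'N(N) -> ('P^* %% N)%act B (coset N h) = h @: B.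
  move=> /imsetP[x _ ->] h nNh; apply: modactE => //.
  apply/afixP=> a /setIP[_ Na].
  apply: (astabs_setact (to := 'P)).
  exact: subsetP (acts_orbit 'P x (subsetT N)) a Na.
rewrite val_subact orbE ?(valP A) //; case: ifP => // /negP[].
rewrite inE; apply/andP; split; first by rewrite mem_quotient // inE.
rewrite !inE; apply/subsetP=> B; rewrite !inE => orbB; rewrite orbE //.
case/imsetP: orbB => x _ ->; apply/imsetP; exists (g x) => //.
apply/setP=> y; apply/imsetP/orbitP => [[z /orbitP[n Nn <-] ->]|[n Nn <-]].
  exists (n ^ g); first by rewrite memJ_norm.
  by rewrite /= /aperm permJ.
exists ((n ^ g^-1) x).
  by apply/orbitP; exists (n ^ g^-1); rewrite ?memJ_norm ?groupV.
by rewrite /= /aperm conjgE invgK !permM permKV.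
Qed.

End Quotient.

Arguments quotient_arc {T} e N.
Arguments quotient_graph_action {T} N.

(* Main.v *)
(* Arcs and geodesics of the quotient lift to the digraph, since N is          *)
(* transitive on each of its orbits; this gives geodesic transitivity, and     *)
(* maximality of N gives the (bi-)quasiprimitivity.  If some arc of the        *)
(* quotient can be reversed then all can, so there is a path a -> b -> a' with *)
(* a and a' in one N-orbit.  It is a 2-geodesic, as no arc lies inside an      *)
(* orbit.  A 2-geodesic of the quotient would lift to a 2-geodesic with ends   *)
(* in distinct orbits, contradicting transitivity on 2-geodesics; so the       *)
(* connected quotient is complete.                                             *)
Require Import Defs.
From mathcomp Require Import all_boot all_fingroup.

Local Open Scope group_scope.

(** The projection to [N]-orbits loses no path: as [N] acts by automorphisms, an arc of the quotient
    lifts from any chosen vertex of its source orbit ([quotient_arcP]). So geodesics lift to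
    geodesics ([lift_geodesic]), and elements of [G] matching the lifts match the originals modulo
    [N]; connectedness simply projects. A nontrivial normal subgroup of [G / N] pulls back to a
    normal subgroup of [G] strictly above [N], so by maximality it has at most two orbits
    ([maximal_quotient_norbits]); the kernel of the action is trivial for the same reason. For the
    last claim, [arc_between_orbits] excludes loops. One reversible arc yields a 2-geodesic with
    ends in a common orbit, hence every 2-geodesic has such ends, and adjacency in the quotient
    becomes symmetric and transitive on distinct vertices ([quotient_digraph_or_complete]). *)

(** * Shortest paths and geodesics *)

(** Frees later proofs from the [find] in [dist]. A path shortens to one without repeated vertices,
    of length below [#|T|], so the distance to its end is never the junk value. *)
Lemma geodesicP {T : finType} (e : rel T) n u p :
  reflect [/\ size p = n, path e u p
            & forall q, path e u q -> last u q = last u p -> n <= size q]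
          (geodesic e n u p).
Proof.
set v := last u p.
have walkP m : reflect (exists q, [/\ size q = m, path e u q & last u q = v])
    [exists q : m.-tuple T, path e u q && (last u q == v)].
  apply: (iffP existsP) => [[q /andP[pq /eqP lq]]|[q [<- pq lq]]].
    by exists q; rewrite size_tuple.
  by exists (in_tuple q); rewrite /= pq lq eqxx.
have short : path e u p -> exists2 q, size q < #|T| & path e u q /\ last u q = v.
  rewrite /v => /shortenP[q pq uq _]; exists q => //.
  by rewrite -[(size q).+1]/(size (u :: q)) -(card_uniqP uq) max_card.
have dist_lt : path e u p -> dist e u v < #|T|.
  move=> /short[q lt_q [pq lq]].
  rewrite /dist -[X in _ < X](size_iota 0) -has_find; apply/hasP.
  by exists (size q); [rewrite mem_iota | apply/walkP; exists q].
apply: (iffP and3P) => [[/eqP sp pp /eqP dp]|[sp pp min_p]].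
  split=> // q pq lq; rewrite leqNgt; apply/negP=> lt_qn.
  move: (lt_qn) (dist_lt pp); rewrite -{1}dp => /(before_find 0).
  rewrite -/v dp => + lt_nT; rewrite nth_iota ?(ltn_trans lt_qn) // add0n.
  by move/walkP; apply; exists q.
have lt := dist_lt pp; split=> //; first exact/eqP.
rewrite -/v eqn_leq; apply/andP; split; last first.
  have: has (fun n => [exists q : n.-tuple T, path e u q && (last u q == v)])
            (iota 0 #|T|) by rewrite has_find size_iota.
  move/(nth_find 0); rewrite -/(dist e u v) nth_iota // add0n.
  by move/walkP=> [q [<- pq lq]]; apply: min_p.
rewrite leqNgt; apply/negP=> lt_n.
have := before_find 0 lt_n; rewrite nth_iota ?(ltn_trans lt_n) // add0n.
by move/walkP; apply; exists p.
Qed.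

Lemma geodesic0 {T : finType} (e : rel T) u : geodesic e 0 u [::].
Proof. by apply/geodesicP; split. Qed.

Lemma geodesic1 {T : finType} {e : rel T} {u v} :
  u != v -> e u v -> geodesic e 1 u [:: v].
Proof.
move=> neq_uv euv; apply/geodesicP; split; rewrite /= ?euv //.
by case=> [_ /= eq_uv|//]; rewrite eq_uv eqxx in neq_uv.
Qed.

Lemma geodesic2 {T : finType} {e : rel T} {u v w} :
  u != w -> ~~ e u w -> e u v -> e v w -> geodesic e 2 u [:: v; w].
Proof.
move=> neq_uw not_euw euv evw; apply/geodesicP; split; rewrite /= ?euv ?evw //.
case=> [_ /= eq_uw|x [|//]]; first by rewrite eq_uw eqxx in neq_uw.
by rewrite /= andbT => eux eq_xw; rewrite -eq_xw eux in not_euw.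
Qed.

Lemma connect_homo {T T' : finType} (e : rel T) (e' : rel T') (f : T -> T') :
  {homo f : x y / e x y >-> connect e' x y} ->
  {homo f : x y / connect e x y >-> connect e' x y}.
Proof.
move=> fe x y /connectP[p]; elim: p x => [|z p IHp] x /= => [_ ->|] //.
by case/andP=> exz pzp ly; apply: connect_trans (fe _ _ exz) (IHp _ pzp ly).
Qed.

(** By induction along a walk, its start equals or is adjacent to each vertex met. This turns
    connectedness of the quotient into completeness. *)
Lemma connect_symmetric_trans {T : finType} (e : rel T) :
  symmetric e -> (forall x y z, e x y -> e y z -> x != z -> e x z) ->
  forall x y, connect (fun u v => e u v || e v u) x y -> x != y -> e x y.
Proof.
move=> symE trE x y /connectP[p]; elim/last_ind: p y => [|p z IHp] y.
  by move=> _ /= ->; rewrite eqxx.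
rewrite rcons_path last_rcons => /andP[pp ez] ->.
have {}ez: e (last x p) z by case/orP: ez; rewrite // symE.
have [-> //|neq_x] := eqVneq x (last x p).
exact: trE (IHp _ pp erefl neq_x) ez.
Qed.

(** * Orbits, their number, and the action on them *)

Lemma norbits_gt0 {aT : finGroupType} {D : {set aT}} {T : finType}
    (to : action D T) (K : {set aT}) (x : T) : 0 < norbits to K.
Proof. by apply/card_gt0P; exists (orbit to K x); apply: imset_f. Qed.

Lemma norbits1_trans {aT : finGroupType} {D : {group aT}} {T : finType}
    (to : action D T) (K : {group aT}) :
  norbits to K = 1%N -> [transitive K, on [set: T] | to].
Proof.
move/eqP/cards1P=> [O defO]; rewrite /atrans defO inE eq_sym; apply/eqP.
apply/setP=> x; rewrite inE.
have /set1P <-: orbit to K x \in [set O] by rewrite -defO imset_f.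
exact: orbit_refl.
Qed.

Section OrbitClass.

Context {T : finType} (N : {group {perm T}}).

Definition orbit_class (x : T) : quotient_vertex N :=
  Sub (orbit 'P N x) (imset_f _ (in_setT x)).

Lemma val_orbit_class x : val (orbit_class x) = orbit 'P N x.
Proof. exact: SubK. Qed.

Lemma orbit_class_surj (A : quotient_vertex N) : exists x, A = orbit_class x.
Proof.
by case/imsetP: (valP A) => x _ defA; exists x; apply: val_inj.
Qed.

Lemma orbit_class_eq x y : (orbit_class x == orbit_class y) = (x \in orbit 'P N y).
Proof. by rewrite -val_eqE !val_orbit_class; apply/eqP/orbit_eqP. Qed.

Lemma orbit_classP x y :
  reflect (exists2 n, n \in N & n x = y) (orbit_class y == orbit_class x).
Proof. by rewrite orbit_class_eq; apply: (iffP orbitP). Qed.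

Lemma orbit_perm x (g : {perm T}) :
  g \in 'N(N) -> g @: orbit 'P N x = orbit 'P N (g x).
Proof.
move=> nNg; apply/setP=> y; apply/imsetP/orbitP.
  by case=> z /orbitP[n Nn <-] ->; exists (n ^ g); rewrite ?memJ_norm //= /aperm permJ.
case=> n Nn <-; exists ((n ^ g^-1) x).
  by apply/orbitP; exists (n ^ g^-1); rewrite ?memJ_norm ?groupV.
by rewrite /= /aperm conjgE invgK !permM permKV.
Qed.

Lemma quotient_action_class x (g : {perm T}) : g \in 'N(N) ->
  quotient_graph_action N (orbit_class x) (coset N g) = orbit_class (g x).
Proof.
move=> nNg; apply: val_inj.
by rewrite quotient_graph_actionE // !val_orbit_class orbit_perm.
Qed.

(** Stabilizers of the restricted action are cut down to its domain, so [acts] needs this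
    membership; it holds because the normalizer of [N] permutes the [N]-orbits. *)
Lemma coset_in_quotient_action_dom (g : {perm T}) : g \in 'N(N) ->
  coset N g \in subact_dom (fun A => A \in orbit 'P N @: [set: T]) ('P^* %% N).
Proof.
move=> nNg; rewrite inE; apply/andP; split; first by rewrite mem_quotient ?inE.
rewrite !inE; apply/subsetP=> B; rewrite !inE => /imsetP[x _ ->].
have -> : ('P^* %% N)%act (orbit 'P N x) (coset N g) = g @: orbit 'P N x.
  apply: modactE => //; apply/afixP=> a /setIP[_ Na].
  apply: (astabs_setact (to := 'P)).
  exact: subsetP (acts_orbit 'P x (subsetT N)) a Na.
by rewrite orbit_perm ?imset_f.
Qed.

Lemma quotient_acts (M : {set {perm T}}) :
  [acts M / N, on [set: quotient_vertex N] | quotient_graph_action N].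
Proof.
apply/subsetP=> _ /morphimP[g nNg _ ->]; rewrite in_setI.
rewrite coset_in_quotient_action_dom // inE.
by apply/subsetP=> A _; rewrite !inE.
Qed.

Lemma norbits_quotient (M : {group {perm T}}) : M \subset 'N(N) -> N \subset M ->
  norbits (quotient_graph_action N) (M / N) <= norbits 'P M.
Proof.
move=> nNM sNM; pose h (O : {set T}) := [set A : quotient_vertex N | val A \subset O].
apply: leq_trans (leq_imset_card h _); apply/subset_leq_card/subsetP=> O.
case/imsetP=> A _ ->; have [x ->] := orbit_class_surj A.
apply/imsetP; exists (orbit 'P M x); first exact: imset_f.
apply/setP=> B; have [y ->] := orbit_class_surj B; rewrite inE val_orbit_class.
apply/orbitP/subsetP=> [[_ /morphimP[g nNg Mg ->] /=]|sub].
  rewrite quotient_action_class // => /esym/eqP/orbit_classP[n Nn <-] z.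
  case/orbitP=> m Nm <-; apply/orbitP; exists (g * n * m).
    by rewrite !groupM // (subsetP sNM).
  by rewrite /= /aperm !permM.
have /orbitP[g Mg /= <-] := sub y (orbit_refl _ _ _).
exists (coset N g); first exact: mem_quotient.
by rewrite quotient_action_class ?(subsetP nNM).
Qed.

End OrbitClass.

(** * Arcs and geodesics of the quotient *)

Section QuotientArc.

Context {T : finType} {e : rel T} {N : {group {perm T}}}.

Lemma quotient_arc_class x y :
  e x y -> quotient_arc e N (orbit_class N x) (orbit_class N y).
Proof.
move=> exy; apply/existsP; exists x; rewrite val_orbit_class orbit_refl andTb.
by apply/existsP; exists y; rewrite val_orbit_class orbit_refl.
Qed.

Lemma quotient_arc_connected :
  graph_connected e -> graph_connected (quotient_arc e N).
Proof.
move=> conn A B.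
have [[x ->] [y ->]] := (orbit_class_surj N A, orbit_class_surj N B).
apply: connect_homo (conn x y) => {}x {}y exy; apply: connect1.
by case/orP: exy => /quotient_arc_class ->; rewrite ?orbT.
Qed.

Hypothesis autN : N \subset graph_aut e.

Lemma quotient_arcP x A :
  reflect (exists2 y, A = orbit_class N y & e x y)
          (quotient_arc e N (orbit_class N x) A).
Proof.
apply: (iffP idP) => [|[y -> /quotient_arc_class //]].
case/existsP=> a /andP[+ /existsP[b /andP[+ eab]]].
have [y ->] := orbit_class_surj N A; rewrite !val_orbit_class.
rewrite -!orbit_class_eq => /orbit_classP[n Nn defa] /eqP <-.
(* Since [n] takes [x] to [a], its inverse pulls the arc from [a] to [b] back to one leaving [x]. *)
exists (n^-1 b).
  by apply/eqP/orbit_classP; exists n; rewrite ?permKV.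
have := subsetP autN _ Nn; rewrite inE => /forallP/(_ x)/forallP/(_ (n^-1 b)).
by rewrite permKV defa eab => /eqP <-.
Qed.

Lemma lift_path x P : path (quotient_arc e N) (orbit_class N x) P ->
  exists2 p, path e x p & P = map (orbit_class N) p.
Proof.
elim: P x => [|A P IHP] x /=; first by exists [::].
case/andP=> /quotient_arcP[y -> exy] /IHP[p pp ->].
by exists (y :: p); rewrite //= exy.
Qed.

Lemma project_path x p :
  path e x p -> path (quotient_arc e N) (orbit_class N x) (map (orbit_class N) p).
Proof. by apply: homo_path => y z; apply: quotient_arc_class. Qed.

(** A shorter path between the ends of the lift would project to a shorter path in the quotient. *)
Lemma lift_geodesic i x P : geodesic (quotient_arc e N) i (orbit_class N x) P ->
  exists2 p, geodesic e i x p & P = map (orbit_class N) p.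
Proof.
case/geodesicP=> sP /lift_path[p pp defP] minP; exists p => //.
apply/geodesicP; split=> // [|q pq lq]; first by rewrite -sP defP size_map.
rewrite -(size_map (orbit_class N) q); apply: minP; first exact: project_path.
by rewrite defP !last_map lq.
Qed.

End QuotientArc.

Lemma quotient_geodesic_transitive {T : finType} {e : rel T}
    {G N : {group {perm T}}} {s} :
  G \subset graph_aut e -> N <| G -> geodesic_transitive e 'P G s ->
  geodesic_transitive (quotient_arc e N) (quotient_graph_action N) (G / N) s.
Proof.
move=> autG /andP[sNG nNG] [_ trG].
have autN := subset_trans sNG autG.
split; [split|].
- exact: quotient_acts.
- move=> _ /morphimP[g nNg Gg ->] A B.
  have eg u v : e (g u) (g v) = e u v.
    by have:= subsetP autG _ Gg; rewrite inE => /forallP/(_ u)/forallP/(_ v)/eqP.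
  have [[x ->] [y ->]] := (orbit_class_surj N A, orbit_class_surj N B).
  rewrite /= !quotient_action_class //; apply/(quotient_arcP autN)/(quotient_arcP autN).
    case=> z defz egxz; exists (g^-1 z); last by rewrite -eg permKV.
    have nNgV: g^-1 \in 'N(N) by rewrite groupV.
    by rewrite -quotient_action_class // -defz quotient_action_class // permK.
  case=> z defz exz; exists (g z); last by rewrite eg.
  by rewrite -quotient_action_class // defz quotient_action_class.
move=> i le_is A B P Q.
have [[x ->] [y ->]] := (orbit_class_surj N A, orbit_class_surj N B).
move=> /(lift_geodesic autN)[p gp ->] /(lift_geodesic autN)[q gq ->].
have [g Gg def_yq] := trG _ le_is _ _ _ _ gp gq.
exists (coset N g); first exact: mem_quotient.
rewrite -!map_cons def_yq -!map_comp; apply: eq_map => z /=.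
by rewrite quotient_action_class ?(subsetP nNG).
Qed.

Lemma geodesic_transitive_vertices {aT : finGroupType} {D : {set aT}} {T : finType}
    {to : action D T} {e : rel T} {G : {group aT}} {s} (x : T) :
  geodesic_transitive e to G s -> [transitive G, on [set: T] | to].
Proof.
case=> _ trG; apply/imsetP; exists x; rewrite ?inE //.
apply/setP=> y; rewrite inE; apply/esym/orbitP.
by have [g Gg [->]] := trG 0 isT x y _ _ (geodesic0 e x) (geodesic0 e y); exists g.
Qed.

Lemma geodesic_transitive_leq {aT : finGroupType} {D : {set aT}} {T : finType}
    {to : action D T} {e : rel T} {G : {set aT}} {m n} :
  m <= n -> geodesic_transitive e to G n -> geodesic_transitive e to G m.
Proof.
by move=> le_mn [actG trG]; split=> // i le_im; apply: trG; apply: leq_trans le_mn.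
Qed.

(** * Maximality of [N] and the action of [G / N] *)

Section MaximalNormal.

Context {T : finType} {G N : {group {perm T}}}.
Hypothesis maxN : [max N | N <| G & 3 <= norbits 'P N].

Lemma maximal_normal : N <| G.
Proof. by case/maxgroupP: maxN => /andP[]. Qed.

Lemma maximal_norbits : 3 <= norbits 'P N.
Proof. by case/maxgroupP: maxN => /andP[]. Qed.

(** Write [K] as [M / N]. If [K] had three orbits, so would [M] by [norbits_quotient]; maximality
    would give [M = N] and make [K] trivial. *)
Lemma maximal_quotient_norbits (K : {group coset_of N}) :
  K <| G / N -> K :!=: 1 -> norbits (quotient_graph_action N) K <= 2.
Proof.
case/(inv_quotientN maximal_normal)=> M -> sNM nMG; rewrite leqNgt => ntM.
have sMG := normal_sub nMG.
have nNM := subset_trans sMG (normal_norm maximal_normal).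
apply: contra ntM => lt2; case/maxgroupP: maxN => _ /(_ M).
rewrite nMG (leq_trans lt2) ?norbits_quotient // => -> //.
by rewrite trivg_quotient.
Qed.

(** The kernel fixes every vertex, so it has as many orbits as [N], at least three; a nontrivial
    normal subgroup has at most two. *)
Lemma maximal_quotient_faithful :
  [faithful G / N, on [set: quotient_vertex N] | quotient_graph_action N].
Proof.
pose q := quotient_graph_action N.
pose K := ('C_(G / N)([set: quotient_vertex N] | q))%G.
have nKG : K <| G / N.
  exact: normalGI (quotient_acts N G) (astab_normal _ _).
have orbK A : orbit q K A = [set A].
  apply/orbit1P/afixP=> a /setIP[_ cKa].
  by rewrite (astab_act cKa) ?inE.
have norbK : norbits q K = norbits 'P N.
  rewrite /norbits (eq_imset _ orbK) card_imset; last exact: set1_inj.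
  by rewrite cardsT card_sig; apply: eq_card => A; rewrite inE.
rewrite /faithful subG1; apply/negPn/negP=> ntK.
have := maximal_quotient_norbits K nKG ntK.
by rewrite norbK leqNgt maximal_norbits.
Qed.

Lemma maximal_quotient_quasiprimitive :
  [transitive G / N, on [set: quotient_vertex N] | quotient_graph_action N] ->
  quasiprimitive (quotient_graph_action N) (G / N) \/
    bi_quasiprimitive (quotient_graph_action N) (G / N).
Proof.
move=> trG; pose q := quotient_graph_action N.
have permG : transitive_permutation_group q (G / N).
  by split=> //; apply: maximal_quotient_faithful.
have [K /and3P[nKG ntK /eqP norbK]|no2] :=
    pickP (fun K : {group coset_of N} => [&& K <| G / N, K :!=: 1 & norbits q K == 2]).
  by right; split=> //; [apply: maximal_quotient_norbits | exists K].
left; split=> // K nKG ntK; apply: norbits1_trans.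
have [A _ _] := imsetP trG.
have := maximal_quotient_norbits K nKG ntK.
have := norbits_gt0 q K A; have := no2 K; rewrite nKG ntK /= -/q.
by case: (norbits q K) => [|[|[|]]].
Qed.

End MaximalNormal.

(** * Reversible arcs and completeness *)

Section DigraphOrComplete.

Context {T : finType} {e : rel T} {G N : {group {perm T}}} {s : nat}.
Hypotheses (digraph_e : digraph e) (conn_e : graph_connected e).
Hypotheses (autG : G \subset graph_aut e) (nNG : N <| G).
Hypothesis trG : geodesic_transitive e 'P G s.

Let autN : N \subset graph_aut e := subset_trans (normal_sub nNG) autG.

Lemma arc_neq {x y} : e x y -> x != y.
Proof.
by move=> exy; apply: contraTneq exy => ->; have [-> _] := digraph_e.
Qed.

Lemma orbit_class_perm x y (g : {perm T}) : g \in G ->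
  (orbit_class N (g x) == orbit_class N (g y)) = (orbit_class N x == orbit_class N y).
Proof.
move/(subsetP (normal_norm nNG)) => nNg.
by rewrite -!quotient_action_class // (inj_eq (act_inj _ _)).
Qed.

(* Otherwise all arcs, hence all vertices by connectedness, lie in one orbit. *)
Lemma arc_between_orbits x y :
  0 < s -> 1 < norbits 'P N -> e x y -> orbit_class N x != orbit_class N y.
Proof.
move=> s_gt0 N_gt1 exy; apply: contraL N_gt1 => eq_xy.
have arc_in u v : e u v -> orbit_class N u = orbit_class N v.
  move=> euv; have [_ /(_ _ s_gt0 _ _ _ _)] := trG.
  move=> /(_ _ _ _ _ (geodesic1 (arc_neq exy) exy) (geodesic1 (arc_neq euv) euv)).
  by case=> g Gg [-> ->]; apply/eqP; rewrite /= orbit_class_perm.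
have all_in u : orbit_class N u = orbit_class N x.
  have cl : closed (fun u v => e u v || e v u)
                   [pred v | orbit_class N v == orbit_class N x].
    by move=> v w /= /orP[] /arc_in; rewrite !inE => ->.
  by have := closed_connect cl (conn_e u x); rewrite !inE eqxx => /eqP.
rewrite -leqNgt -(cards1 (orbit 'P N x)); apply/subset_leq_card/subsetP=> O.
case/imsetP=> u _ ->; rewrite inE -!val_orbit_class; apply/eqP.
by rewrite all_in.
Qed.

Lemma quotient_digraph_or_complete : 2 <= s -> 1 < norbits 'P N ->
  digraph (quotient_arc e N) \/ complete_graph (quotient_arc e N).
Proof.
move=> s_ge2 N_gt1; pose a := quotient_arc e N.
have s_gt0 := ltnW s_ge2.
have orb_neq x y : e x y -> orbit_class N x != orbit_class N y.
  exact: arc_between_orbits.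
have a_irr A : a A A = false.
  have [x ->] := orbit_class_surj N A.
  by apply/(quotient_arcP autN) => -[y /eqP eqxy /orb_neq]; rewrite eqxy.
have [rev|no_rev] := pickP (fun AB => a AB.1 AB.2 && a AB.2 AB.1); last first.
  by left; split=> // A B; have /= -> := no_rev (A, B).
move=> /andP[]; have [x ->] := orbit_class_surj N rev.1.
case/(quotient_arcP autN)=> y -> exy /(quotient_arcP autN)[z /eqP eq_xz eyz].
(* Antisymmetry of [e] gives [x != z]; an arc from [x] to [z] would lie inside one orbit. *)
have geo_xyz : geodesic e 2 x [:: y; z].
  apply: geodesic2 => //.
    apply: contraTneq exy => eqxz; apply/negP=> exy.
    have [_ /(_ x y)] := digraph_e; rewrite exy eqxz eyz => /(_ isT) eqzy.
    by have := arc_neq eyz; rewrite eqzy eqxx.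
  by apply: contraL eq_xz => /orb_neq.
have a_sym : symmetric a.
  suff sub C D : a C D -> a D C by move=> C D; apply/idP/idP; apply: sub.
  have [u ->] := orbit_class_surj N C.
  case/(quotient_arcP autN)=> v -> euv; have [_ /(_ _ s_gt0 _ _ _ _)] := trG.
  move=> /(_ _ _ _ _ (geodesic1 (arc_neq exy) exy) (geodesic1 (arc_neq euv) euv)).
  (* The arc from [u] to [v] is the [g]-image of that from [x] to [y], so [g z], in the orbit of
     [g x], ends a reverse arc. *)
  case=> g Gg [-> ->]; apply/(quotient_arcP autN); exists (g z).
    by apply/eqP; rewrite orbit_class_perm.
  by have := subsetP autG _ Gg; rewrite inE => /forallP/(_ y)/forallP/(_ z)/eqP->.
have a_trans C D E : a C D -> a D E -> C != E -> a C E.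
  have [u ->] := orbit_class_surj N C.
  case/(quotient_arcP autN)=> v -> euv /(quotient_arcP autN)[w -> evw] neq_uw.
  (* Without the arc, [u], [v], [w] is a 2-geodesic, hence an image of [x], [y], [z], so [u] and [w]
     share an orbit. *)
  apply: contraNT (neq_uw) => not_auw.
  have geo_uvw : geodesic e 2 u [:: v; w].
    apply: geodesic2 => //; first by apply: contraNneq neq_uw => ->.
    by apply: contra not_auw; apply: quotient_arc_class.
  have [_ /(_ _ s_ge2 _ _ _ _ geo_xyz geo_uvw)[g Gg [-> _ ->]]] := trG.
  by rewrite /= orbit_class_perm.
right=> C D; have [->|neqCD] := eqVneq C D; first exact: a_irr.
have conn_a := quotient_arc_connected conn_e C D.
exact: connect_symmetric_trans a_sym a_trans _ _ conn_a neqCD.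
Qed.

End DigraphOrComplete.

Theorem theorem1p1 (T : finType) (e : rel T) (G N : {group {perm T}}) (s : nat) :
  digraph e ->
  graph_connected e ->
  G \subset graph_aut e ->
  2 <= s ->
  geodesic_transitive e 'P G s ->
  [max N | N <| G & 3 <= norbits 'P N] ->
  [/\ graph_connected (quotient_arc e N),
      geodesic_transitive (quotient_arc e N) (quotient_graph_action N) (G / N)
        (minn s (diam (quotient_arc e N))),
      quasiprimitive (quotient_graph_action N) (G / N) \/
        bi_quasiprimitive (quotient_graph_action N) (G / N)
    & digraph (quotient_arc e N) \/
        complete_graph (quotient_arc e N)].
Proof.
move=> digraph_e conn_e autG s_ge2 trG maxN.
have nNG := maximal_normal maxN; have N_ge3 := maximal_norbits maxN.
have trGN := quotient_geodesic_transitive autG nNG trG.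
have /card_gt0P[_ /imsetP[x _ _]] : 0 < norbits 'P N by apply: ltn_trans N_ge3.
split.
- exact: quotient_arc_connected.
(* Transitivity holds up to [s] itself, so in particular up to the minimum. *)
- exact: geodesic_transitive_leq (geq_minl _ _) trGN.
- apply: maximal_quotient_quasiprimitive maxN _.
  exact: geodesic_transitive_vertices (orbit_class N x) trGN.
- exact: quotient_digraph_or_complete digraph_e conn_e autG nNG trG s_ge2 (ltnW N_ge3).
Qed.
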